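(* Let $\alpha_0,\ldots,\alpha_4$ be complex parameters with $\alpha_0+\alpha_1+\alpha_2+\alpha_3+\alpha_4=1$, and consider the system $$\begin{aligned} \frac{dq_1}{dt}&=2q_1^2+p_1+2t+4p_2+3p_4, & \frac{dp_1}{dt}&=-4q_1p_1+2q_2p_2-2\alpha_0,\\ \frac{dq_2}{dt}&=q_2^2-4p_2+4p_1-2q_1q_2, & \frac{dp_2}{dt}&=-2q_2p_2+2q_1p_2-\alpha_1,\\ \frac{dq_3}{dt}&=q_3^2-4p_3+4p_4-2q_3q_4, & \frac{dp_3}{dt}&=-2q_3p_3+2q_4p_3-\alpha_3,\\ \frac{dq_4}{dt}&=2q_4^2+p_4+2t+3p_1+4p_3, & \frac{dp_4}{dt}&=-4q_4p_4+2q_3p_3-2\alpha_4. \end{aligned}$$ This system has the following invariant divisors: (i) if $\alpha_0=0$, then $f_0:=p_1+\frac{q_2^2}{4}$ is an invariant divisor; (ii) if $\alpha_1=0$, then $f_1:=p_2$ is an invariant divisor; (iii) if $\alpha_2=0$, then $f_2:=p_2+\frac{p_1+p_4}{2}+p_3+t+\frac{q_1q_2}{2}+\frac{q_3q_4}{2}-\frac{q_2q_3}{4}$ is an invariant divisor; (iv) if $\alpha_3=0$, then $f_3:=p_3$ is an invariant divisor; (v) if $\alpha_4=0$, then $f_4:=p_4+\frac{q_3^2}{4}$ is an invariant divisor.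
   Context: A polynomial $f\in\mathbb{C}(t)[q_1,p_1,\ldots,q_4,p_4]$ is an invariant divisor of the system if its total derivative $\frac{df}{dt}$ along the system (i.e. $\frac{\partial f}{\partial t}$ plus the derivative of $f$ along the vector field given by the right-hand sides) is divisible by $f$ in $\mathbb{C}(t)[q_1,p_1,\ldots,q_4,p_4]$; thus the locus $f=0$ is preserved by the flow. *)

(* Defs.v *)
From HB Require Import structures.
From mathcomp Require Import all_boot all_order all_algebra generic_quotient.
From mathcomp Require Import fraction ring.
From mathcomp Require Export reals complex mpoly.

Set Implicit Arguments.
Unset Strict Implicit.
Unset Printing Implicit Defensive.

Import GRing.Theory.
Local Open Scope ring_scope.
Local Open Scope quotient_scope.

Local Notation "x %:F" := (@tofrac _ x).

Notation ratfun F := {fraction {poly F}}.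

(* The quotient rule for a morphism [phi] into an abstract field; it is stated
   at this generality to keep the construction of [{fraction _}] out of the way
   of unification. *)
Section QuotientRule.
Variables (A : comNzRingType) (K : fieldType) (phi : {rmorphism A -> K}).
Variables (a b c d a' b' c' d' : A).
Hypotheses (b0 : phi b != 0) (d0 : phi d != 0).

Lemma quot_crossE : phi a / phi b = phi c / phi d -> phi (a * d) = phi (c * b).
Proof. by move/eqP; rewrite eqr_div // !rmorphM => /eqP. Qed.

Lemma quot_rule_eq : a * d = c * b ->
    a' * d + a * d' = c' * b + c * b' ->
  phi (a' * b - a * b') / phi b ^+ 2 = phi (c' * d - c * d') / phi d ^+ 2.
Proof.
move=> e e'; apply/eqP; rewrite eqr_div ?expf_neq0 // -!rmorphXn -!rmorphM.
apply/eqP; congr (phi _).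
transitivity ((a' * d + a * d') * b * d - (a * d) * (b' * d + b * d')).
  by ring.
by rewrite e' e; ring.
Qed.

Lemma quot_sub : phi a / phi b - phi c / phi d = phi (a * d - c * b) / phi (b * d).
Proof. by rewrite rmorphB !rmorphM; field; rewrite b0 d0. Qed.

Lemma quot_mul : phi a / phi b * (phi c / phi d) = phi (a * c) / phi (b * d).
Proof. by rewrite !rmorphM; field; rewrite b0 d0. Qed.

Lemma quot_rule_sub :
  phi ((a' * d + a * d' - (c' * b + c * b')) * (b * d)
       - (a * d - c * b) * (b' * d + b * d')) / phi (b * d) ^+ 2 =
  phi (a' * b - a * b') / phi b ^+ 2 - phi (c' * d - c * d') / phi d ^+ 2.
Proof.
by rewrite !(rmorphB, rmorphD, rmorphM) /=; field; rewrite b0 d0.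
Qed.

Lemma quot_rule_mul :
  phi ((a' * c + a * c') * (b * d) - (a * c) * (b' * d + b * d'))
    / phi (b * d) ^+ 2 =
  phi (a' * b - a * b') / phi b ^+ 2 * (phi c / phi d)
  + phi a / phi b * (phi (c' * d - c * d') / phi d ^+ 2).
Proof.
by rewrite !(rmorphB, rmorphD, rmorphM) /=; field; rewrite b0 d0.
Qed.

End QuotientRule.

Section RationalFunctions.
Variable F : fieldType.

Definition ratC (c : F) : ratfun F := (c%:P)%:F.

Definition ratt : ratfun F := 'X%:F.

(* d/dt on F(t), by the quotient rule on a chosen representative;
   [ratfun_derivE] shows independence of that choice. *)
Definition ratfun_deriv (x : ratfun F) : ratfun F :=
  let r := repr x in
  ((\n_r)^`() * \d_r - \n_r * (\d_r)^`())%:F / (\d_r)%:F ^+ 2.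

Lemma ratfun_repr (x : ratfun F) :
  x = (\n_(repr x))%:F / (\d_(repr x))%:F.
Proof.
have dn0 := denom_ratioP (repr x).
have d0 : (\d_(repr x))%:F != 0 by rewrite tofrac_eq0.
apply: (mulIf d0); rewrite mulfVK // -{1}[x]reprK /tofrac; unlock.
rewrite -[LHS]/(FracField.mul _ _) -!FracField.pi_mul.
apply/eqmodP; rewrite /= FracField.equivfE /FracField.mulf.
by rewrite !numden_Ratio ?mulr1 ?oner_neq0 // mulrC.
Qed.

Lemma ratfun_derivE (a b : {poly F}) : b != 0 ->
  ratfun_deriv (a%:F / b%:F) = (a^`() * b - a * b^`())%:F / b%:F ^+ 2.
Proof.
move=> b0; set x := _ / _; rewrite /ratfun_deriv.
have xE := ratfun_repr x; move: (denom_ratioP (repr x)) xE.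
move: (\n_(repr x)) (\d_(repr x)) => n d d0 xE.
have bF : b%:F != 0 by rewrite tofrac_eq0.
have dF : d%:F != 0 by rewrite tofrac_eq0.
have adnb : a * d = n * b.
  by apply/eqP; rewrite -tofrac_eq; apply/eqP; exact: (quot_crossE bF dF xE).
apply/esym/(quot_rule_eq bF dF adnb).
by rewrite -!derivM adnb.
Qed.

Lemma ratfun_deriv_zmod : zmod_morphism ratfun_deriv.
Proof.
move=> x y; rewrite (ratfun_repr x) (ratfun_repr y).
move: (denom_ratioP (repr x)) (denom_ratioP (repr y)).
move: (\n_(repr x)) (\d_(repr x)) (\n_(repr y)) (\d_(repr y)) => a b c d b0 d0.
have bF : b%:F != 0 by rewrite tofrac_eq0.
have dF : d%:F != 0 by rewrite tofrac_eq0.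
rewrite (quot_sub a c bF dF) !ratfun_derivE ?mulf_neq0 //.
by rewrite derivB !derivM; exact: (quot_rule_sub _ _ _ _ _ _ bF dF).
Qed.

HB.instance Definition _ :=
  GRing.isZmodMorphism.Build (ratfun F) (ratfun F) ratfun_deriv
    ratfun_deriv_zmod.

Lemma ratfun_derivM (x y : ratfun F) :
  ratfun_deriv (x * y) = ratfun_deriv x * y + x * ratfun_deriv y.
Proof.
rewrite (ratfun_repr x) (ratfun_repr y).
move: (denom_ratioP (repr x)) (denom_ratioP (repr y)).
move: (\n_(repr x)) (\d_(repr x)) (\n_(repr y)) (\d_(repr y)) => a b c d b0 d0.
have bF : b%:F != 0 by rewrite tofrac_eq0.
have dF : d%:F != 0 by rewrite tofrac_eq0.
rewrite (quot_mul a c bF dF) !ratfun_derivE ?mulf_neq0 // !derivM.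
exact: (quot_rule_mul _ _ _ _ _ _ bF dF).
Qed.

Lemma ratfun_deriv_poly (a : {poly F}) : ratfun_deriv a%:F = (a^`())%:F.
Proof.
have := @ratfun_derivE a 1 (oner_neq0 _).
by rewrite tofrac1 divr1 derivC mulr0 subr0 mulr1 expr1n divr1.
Qed.

Lemma ratfun_derivC (c : F) : ratfun_deriv (ratC c) = 0.
Proof. by rewrite ratfun_deriv_poly derivC tofrac0. Qed.

Lemma ratfun_derivt : ratfun_deriv ratt = 1.
Proof. by rewrite ratfun_deriv_poly derivX tofrac1. Qed.

(* Total derivative along dx_i/dt = v i; the first summand is the partial
   derivative in t, which acts on coefficients only. *)
Definition total_deriv (n : nat) (v : 'I_n -> {mpoly (ratfun F)[n]})
    (f : {mpoly (ratfun F)[n]}) : {mpoly (ratfun F)[n]} :=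
  map_mpoly ratfun_deriv f + \sum_(i < n) v i * f^`M(i).

Definition invariant_divisor (n : nat) (v : 'I_n -> {mpoly (ratfun F)[n]})
    (f : {mpoly (ratfun F)[n]}) : Prop :=
  exists g : {mpoly (ratfun F)[n]}, total_deriv v f = g * f.

End RationalFunctions.

Arguments ratt {F}.

Section System.
Variable F : fieldType.

Local Notation poly8 := {mpoly (ratfun F)[8]}.

(* The phase variables, and the equations in [system], are ordered
   q1, p1, q2, p2, q3, p3, q4, p4. *)
Definition q1 : poly8 := 'X_(@Ordinal 8 0 isT).
Definition p1 : poly8 := 'X_(@Ordinal 8 1 isT).
Definition q2 : poly8 := 'X_(@Ordinal 8 2 isT).
Definition p2 : poly8 := 'X_(@Ordinal 8 3 isT).
Definition q3 : poly8 := 'X_(@Ordinal 8 4 isT).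
Definition p3 : poly8 := 'X_(@Ordinal 8 5 isT).
Definition q4 : poly8 := 'X_(@Ordinal 8 6 isT).
Definition p4 : poly8 := 'X_(@Ordinal 8 7 isT).
Definition t : poly8 := ratt%:MP.
Definition cst (c : F) : poly8 := (ratC c)%:MP.

Definition system (alpha0 alpha1 alpha3 alpha4 : F) (i : 'I_8) : poly8 :=
  tnth [tuple
    2 * q1 ^+ 2 + p1 + 2 * t + 4 * p2 + 3 * p4;
    - 4 * q1 * p1 + 2 * q2 * p2 - 2 * cst alpha0;
    q2 ^+ 2 - 4 * p2 + 4 * p1 - 2 * q1 * q2;
    - 2 * q2 * p2 + 2 * q1 * p2 - cst alpha1;
    q3 ^+ 2 - 4 * p3 + 4 * p4 - 2 * q3 * q4;
    - 2 * q3 * p3 + 2 * q4 * p3 - cst alpha3;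
    2 * q4 ^+ 2 + p4 + 2 * t + 3 * p1 + 4 * p3;
    - 4 * q4 * p4 + 2 * q3 * p3 - 2 * cst alpha4 ] i.

End System.

Arguments q1 {F}.
Arguments p1 {F}.
Arguments q2 {F}.
Arguments p2 {F}.
Arguments q3 {F}.
Arguments p3 {F}.
Arguments q4 {F}.
Arguments p4 {F}.
Arguments t {F}.

(* Main.v *)
From HB Require Import structures.
Require Import Defs.
From mathcomp Require Import all_boot all_order all_algebra.
From mathcomp Require Import ring.
Import GRing.Theory.
Local Open Scope ring_scope.

(** The total derivative [D] is a derivation of C(t)[q1, p1, ..., q4, p4]: it is
    additive ([total_deriv_zmod]) and satisfies the Leibniz rule
    ([total_derivM]).  It is therefore determined on all the divisors by its
    values on the eight coordinates, which are the right-hand sides of the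
    system ([total_deriv_coord]), and by D t = 1.  Expanding gives the cofactors

      D f0 = (2 q2 - 4 q1) f0 - 2 alpha0,   D f1 = (2 q1 - 2 q2) f1 - alpha1,
      D f4 = (2 q3 - 4 q4) f4 - 2 alpha4,   D f3 = (2 q4 - 2 q3) f3 - alpha3,
      D f2 = (q2 + q3) f2 + 1 - alpha0 - alpha1 - alpha3 - alpha4,

    and the constant remainder of D f2 is alpha2, by the normalization
    alpha0 + ... + alpha4 = 1: this is where D t = 1 enters.  So each remainder
    vanishes exactly when its parameter does.

    The coefficients 1/2 and 1/4 are cleared first: D commutes with integer
    multiples, so f is an invariant divisor as soon as 4 f is
    ([invariant_divisor_natl]), and the identities to check then have integer
    coefficients.  The argument is valid over any field in which 2 is nonzero. *)

(** * The total derivative is a derivation *)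

Lemma ratfun_deriv1 (F : fieldType) : ratfun_deriv (1 : ratfun F) = 0.
Proof. by rewrite -tofrac1 ratfun_deriv_poly derivC tofrac0. Qed.

Section TotalDerivative.
Variables (F : fieldType) (n : nat) (v : 'I_n -> {mpoly (ratfun F)[n]}).
Local Notation D := (total_deriv v).

(** Each coefficient of a product is a convolution of coefficients, and the
    Leibniz rule of d/dt applies to each of its terms. *)
Lemma map_mpoly_derivM (f g : {mpoly (ratfun F)[n]}) :
  map_mpoly (@ratfun_deriv F) (f * g)
  = map_mpoly (@ratfun_deriv F) f * g + f * map_mpoly (@ratfun_deriv F) g.
Proof.
apply/mpolyP => m; rewrite mcoeffD mcoeff_map_mpoly !mcoeffM.
rewrite raddf_sum -big_split /=; apply: eq_bigr => k _.
by rewrite ratfun_derivM !mcoeff_map_mpoly.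
Qed.

Lemma total_deriv_zmod : zmod_morphism D.
Proof.
move=> f g; rewrite /total_deriv raddfB /= opprD addrACA; congr (_ + _).
by rewrite -sumrB; apply: eq_bigr => i _; rewrite mderivB mulrBr.
Qed.

HB.instance Definition _ :=
  GRing.isZmodMorphism.Build {mpoly (ratfun F)[n]} {mpoly (ratfun F)[n]} D
    total_deriv_zmod.

Lemma total_derivM (f g : {mpoly (ratfun F)[n]}) :
  D (f * g) = D f * g + f * D g.
Proof.
rewrite /total_deriv map_mpoly_derivM mulrDl mulrDr addrACA.
congr (_ + _); rewrite mulr_suml mulr_sumr -big_split /=.
by apply: eq_bigr => i _; rewrite mderivM; ring.
Qed.

Lemma total_derivC (c : ratfun F) : D c%:MP = (ratfun_deriv c)%:MP.
Proof.
rewrite /total_deriv map_mpolyC big1 ?addr0 // => i _.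
by rewrite mderivC mulr0.
Qed.

Lemma total_derivX (i : 'I_n) : D 'X_i = v i.
Proof.
rewrite /total_deriv (bigD1 i) //= big1 => [|j ji].
  rewrite mderivX mnm1E eqxx -[X in (X - _)%MM]add0m addmK mpolyX0.
  rewrite scale1r mulr1 addr0 [X in X + _](_ : _ = 0) ?add0r //.
  apply/mpolyP => m; rewrite mcoeff_map_mpoly mcoeffX mcoeff0.
  by rewrite raddfMn /= ratfun_deriv1 mul0rn.
by rewrite mderivX mnm1E eq_sym (negPf ji) scale0r mulr0.
Qed.

End TotalDerivative.

(** * Clearing denominators *)

(** The derivative of k f is k times that of f, so the cofactor of k f is also a
    cofactor of f once k is cancelled. *)
Lemma invariant_divisor_natl {F : fieldType} {n k : nat}
    {v : 'I_n -> {mpoly (ratfun F)[n]}} {f : {mpoly (ratfun F)[n]}} :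
  (k%:R : {mpoly (ratfun F)[n]}) != 0 ->
  invariant_divisor v (k%:R * f) -> invariant_divisor v f.
Proof.
move=> k0 [g gP]; exists g; apply: (mulfI k0).
by rewrite mulrCA -gP !mulr_natl raddfMn.
Qed.

Section NaturalMultiples.
Variables (F : fieldType) (n : nat).

Lemma ratfun_natr_neq0 {k : nat} :
  (k%:R : F) != 0 -> (k%:R : ratfun F) != 0.
Proof.
move=> k0; rewrite -tofrac1 -raddfMn /= tofrac_eq0.
by rewrite -polyC1 -raddfMn /= polyC_eq0.
Qed.

Lemma mpoly_natr_neq0 {k : nat} :
  (k%:R : F) != 0 -> (k%:R : {mpoly (ratfun F)[n]}) != 0.
Proof. by move=> k0; rewrite -mpolyC_nat mpolyC_eq0 ratfun_natr_neq0. Qed.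

Lemma natl_scaleV {k : nat} (f : {mpoly (ratfun F)[n]}) :
  (k%:R : F) != 0 -> k%:R * (k%:R^-1 *: f) = f.
Proof.
move=> k0; have k0' := ratfun_natr_neq0 k0.
by rewrite -mpolyC_nat mul_mpolyC scalerA mulfV // scale1r.
Qed.

Hypothesis two_neq0 : (2 : F) != 0.

Lemma four_neq0 : (4 : F) != 0.
Proof. by rewrite (natrM _ 2 2) mulf_neq0. Qed.

Lemma mul4_half (f : {mpoly (ratfun F)[n]}) : 4 * (2^-1 *: f) = f *+ 2.
Proof. by rewrite (natrM _ 2 2) -mulrA natl_scaleV // mulr_natl. Qed.

(** With a, b, c := p2, p3, t and x, y, z, w := p1 + p4, q1 q2, q3 q4, q2 q3 this
    is 4 f2. *)
Lemma mul4_halves_quarter (a b c x y z w : {mpoly (ratfun F)[n]}) :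
  4 * (a + 2^-1 *: x + b + c + 2^-1 *: y + 2^-1 *: z - 4^-1 *: w)
  = (a + b + c) *+ 4 + (x + y + z) *+ 2 - w.
Proof.
by rewrite mulrBr !mulrDr natl_scaleV ?four_neq0 // !mul4_half; ring.
Qed.

End NaturalMultiples.

(** * The invariant divisors of the system *)

Section System.
Variables (F : fieldType) (alpha0 alpha1 alpha3 alpha4 : F).
Hypothesis two_neq0 : (2 : F) != 0.
Local Notation v := (system alpha0 alpha1 alpha3 alpha4).
Local Notation D := (total_deriv v).

Lemma cst_is_zmod : zmod_morphism (@cst F).
Proof. by move=> a b; rewrite /cst /ratC polyCB rmorphB mpolyCB. Qed.

HB.instance Definition _ :=
  GRing.isZmodMorphism.Build _ _ (@cst F) cst_is_zmod.

Lemma cst1 : cst (1 : F) = 1.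
Proof. by rewrite /cst /ratC polyC1 tofrac1 mpolyC1. Qed.

Lemma total_deriv_t : D t = 1.
Proof. by rewrite total_derivC ratfun_derivt. Qed.

Lemma total_deriv_coord :
  (D q1 = 2 * q1 ^+ 2 + p1 + 2 * t + 4 * p2 + 3 * p4) *
  (D p1 = - 4 * q1 * p1 + 2 * q2 * p2 - 2 * cst alpha0) *
  (D q2 = q2 ^+ 2 - 4 * p2 + 4 * p1 - 2 * q1 * q2) *
  (D p2 = - 2 * q2 * p2 + 2 * q1 * p2 - cst alpha1) *
  (D q3 = q3 ^+ 2 - 4 * p3 + 4 * p4 - 2 * q3 * q4) *
  (D p3 = - 2 * q3 * p3 + 2 * q4 * p3 - cst alpha3) *
  (D q4 = 2 * q4 ^+ 2 + p4 + 2 * t + 3 * p1 + 4 * p3) *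
  (D p4 = - 4 * q4 * p4 + 2 * q3 * p3 - 2 * cst alpha4).
Proof. by do !split; rewrite total_derivX. Qed.

Lemma invariant_divisor_f0 :
  alpha0 = 0 -> invariant_divisor v (p1 + 4^-1 *: q2 ^+ 2).
Proof.
move=> a0.
apply: (invariant_divisor_natl (mpoly_natr_neq0 _ _ (four_neq0 _ two_neq0))).
exists (2 * q2 - 4 * q1).
rewrite mulrDr natl_scaleV ?four_neq0 // expr2 mulr_natl.
rewrite raddfD raddfMn /= total_derivM !total_deriv_coord a0 raddf0.
by ring.
Qed.

Lemma invariant_divisor_f1 : alpha1 = 0 -> invariant_divisor v p2.
Proof.
move=> a1; exists (2 * q1 - 2 * q2).
by rewrite total_deriv_coord a1 raddf0; ring.
Qed.

Lemma invariant_divisor_f2 :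
  alpha0 + alpha1 + alpha3 + alpha4 = 1 ->
  invariant_divisor v
    (p2 + 2^-1 *: (p1 + p4) + p3 + t + 2^-1 *: (q1 * q2)
     + 2^-1 *: (q3 * q4) - 4^-1 *: (q2 * q3)).
Proof.
move=> sum_alpha.
have cst0E : cst alpha0 = 1 - cst alpha1 - cst alpha3 - cst alpha4.
  by rewrite -cst1 -sum_alpha !raddfD /=; ring.
apply: (invariant_divisor_natl (mpoly_natr_neq0 _ _ (four_neq0 _ two_neq0))).
rewrite mul4_halves_quarter //; exists (q2 + q3).
(* The product q2 * q3 is differentiated before the sums are split: additivity
   applied to the opposite of its derivative would unfold that derivative. *)
rewrite raddfB raddfD !raddfMn /= total_derivM !raddfD /= !total_derivM.
rewrite !total_deriv_coord total_deriv_t cst0E.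
by ring.
Qed.

Lemma invariant_divisor_f3 : alpha3 = 0 -> invariant_divisor v p3.
Proof.
move=> a3; exists (2 * q4 - 2 * q3).
by rewrite total_deriv_coord a3 raddf0; ring.
Qed.

Lemma invariant_divisor_f4 :
  alpha4 = 0 -> invariant_divisor v (p4 + 4^-1 *: q3 ^+ 2).
Proof.
move=> a4.
apply: (invariant_divisor_natl (mpoly_natr_neq0 _ _ (four_neq0 _ two_neq0))).
exists (2 * q3 - 4 * q4).
rewrite mulrDr natl_scaleV ?four_neq0 // expr2 mulr_natl.
rewrite raddfD raddfMn /= total_derivM !total_deriv_coord a4 raddf0.
by ring.
Qed.

End System.

Theorem proposition3p2 (R : realType)
    (alpha0 alpha1 alpha2 alpha3 alpha4 : R[i])
    (halpha : alpha0 + alpha1 + alpha2 + alpha3 + alpha4 = 1) :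
  let v := system alpha0 alpha1 alpha3 alpha4 in
  [/\ alpha0 = 0 -> invariant_divisor v (p1 + 4^-1 *: q2 ^+ 2),
      alpha1 = 0 -> invariant_divisor v p2,
      alpha2 = 0 ->
        invariant_divisor v
          (p2 + 2^-1 *: (p1 + p4) + p3 + t + 2^-1 *: (q1 * q2)
           + 2^-1 *: (q3 * q4) - 4^-1 *: (q2 * q3)),
      alpha3 = 0 -> invariant_divisor v p3 &
      alpha4 = 0 -> invariant_divisor v (p4 + 4^-1 *: q3 ^+ 2)].
Proof.
have two_neq0 : (2 : R[i]) != 0 by rewrite Num.Theory.pnatr_eq0.
split; [exact: invariant_divisor_f0 | exact: invariant_divisor_f1 | move=> a2
  | exact: invariant_divisor_f3 | exact: invariant_divisor_f4].
by apply: invariant_divisor_f2 => //; rewrite -halpha a2 addr0.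
Qed.
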